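(* Let $q$ be an even power of a prime. Then \[c(q,8)\le 2\bigl(q^3-q\sqrt q-q\bigr).\]
   Context: For integers $k\ge 2$, $g\ge 3$, $c(k,g)$ denotes the minimum number of vertices of a $k$-regular simple graph of girth $g$ (girth = length of a shortest cycle). *)

(* Defs.v *)
From mathcomp Require Import all_boot all_order all_algebra.
Set Implicit Arguments.
Unset Strict Implicit.
Unset Printing Implicit Defensive.

Record sgraph := SGraph {
  vertex :> finType;
  adj : rel vertex;
  adj_sym : symmetric adj;
  adj_irr : irreflexive adj }.

Definition regular (k : nat) (G : sgraph) : Prop :=
  forall x : G, #|[set y : G | adj x y]| = k.

(* A cycle is given by the list of its distinct vertices in cyclic order. The
   bound on the size excludes [:: x; y] with x adjacent to y, which ucycle
   accepts. *)
Definition graph_cycle (G : sgraph) (s : seq G) : Prop :=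
  2 < size s /\ ucycle (@adj G) s.

Definition has_girth (G : sgraph) (g : nat) : Prop :=
  (exists s : seq G, graph_cycle s /\ size s = g) /\
  (forall s : seq G, graph_cycle s -> g <= size s).

(* [cage_order k g n] means c(k,g) = n. It is a relation, so that no value has
   to be chosen for pairs (k,g) not known to admit a graph. *)
Definition cage_order (k g n : nat) : Prop :=
  (exists G : sgraph, [/\ regular k G, has_girth G g & #|G| = n]) /\
  (forall G : sgraph, regular k G -> has_girth G g -> n <= #|G|).

Lemma cage_order_inj (k g m n : nat) :
  cage_order k g m -> cage_order k g n -> m = n.
Proof.
move=> [[G [rG gG <-]] minG] [[H [rH gH <-]] minH].
by apply/eqP; rewrite eqn_leq minG ?minH.
Qed.

(* Main.v *)
Require Import Defs.
From mathcomp Require Import all_boot all_order all_algebra all_field.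
From mathcomp Require Import ring zify.
From Stdlib Require Import Classical.
Set Implicit Arguments.
Unset Strict Implicit.
Unset Printing Implicit Defensive.
Import Order.TTheory GRing.Theory Num.Theory.
Local Open Scope ring_scope.

(* The cages of degree q + 1 and girth 8 are the incidence graphs of generalized
   quadrangles of order q. Deleting from such a graph a set of vertices such
   that every other vertex has exactly one neighbour in it (a perfect dominating
   set) leaves a q-regular graph that still has no cycle shorter than 8.

   In the symplectic quadrangle W(3,q), q = s^2, let P be a point whose polar
   plane meets a Baer subplane B of the quotient PG(3,q)/P in exactly one point.
   Delete the points of the cone with vertex P over B and the poles of the planes
   through P that correspond to lines of B; delete the totally isotropic lines
   contained in those planes. This removes q^2 + q s + 2 q + 1 points and as many
   lines.

   The surviving vertices have affine coordinates in which everything is explicit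
   in terms of the involution f : t |-> t^s of the field of order q. *)

(** * Cage orders as attained minima *)

Lemma classical_ex_min (P : nat -> Prop) :
  (exists n, P n) -> exists n, P n /\ forall m, P m -> (n <= m)%N.
Proof.
case=> n; elim/ltn_ind: n => n IHn Pn.
have [[m [lt_mn Pm]]|no_smaller] := classic (exists m, (m < n)%N /\ P m).
  exact: IHn lt_mn Pm.
exists n; split=> // m Pm; rewrite leqNgt; apply/negP=> lt_mn.
by apply: no_smaller; exists m.
Qed.

(** [cage_order] demands an attained minimum, so an upper bound on it must come with existence: one
    witness graph gives both. *)
Lemma cage_order_le (k g : nat) (G : sgraph) :
  regular k G -> has_girth G g -> exists2 n, cage_order k g n & (n <= #|G|)%N.
Proof.
move=> regG girthG.
have [|n [realn minn]] := @classical_ex_min (fun n =>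
  exists H : sgraph, [/\ regular k H, has_girth H g & #|H| = n]).
  by exists #|G|, G.
exists n; last by apply: minn; exists G.
by split=> // H regH girthH; apply: minn; exists H.
Qed.

(** * Bipartite incidence graphs *)

Section IncidenceGraph.
Variables (P L : finType) (inc : P -> L -> bool).

Definition inc_adj (u v : P + L) : bool :=
  match u, v with
  | inl p, inr l | inr l, inl p => inc p l
  | _, _ => false
  end.

Lemma inc_adj_sym : symmetric inc_adj.
Proof. by case=> [p|l] [p'|l']. Qed.

Lemma inc_adj_irr : irreflexive inc_adj.
Proof. by case. Qed.

Definition inc_graph : sgraph := SGraph inc_adj_sym inc_adj_irr.

Lemma inc_graph_regular k :
    (forall p, #|[set l | inc p l]| = k) ->
    (forall l, #|[set p | inc p l]| = k) ->
  regular k inc_graph.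
Proof.
move=> degP degL [p|l].
  rewrite -(degP p) -(card_imset _ (@inr_inj P L)); apply: eq_card => v.
  rewrite inE; apply/idP/imsetP => [|[l + ->]]; last by rewrite inE.
  by case: v => //= l pl; exists l; rewrite ?inE.
rewrite -(degL l) -(card_imset _ (@inl_inj P L)); apply: eq_card => v.
rewrite inE; apply/idP/imsetP => [|[p + ->]]; last by rewrite inE.
by case: v => //= p pl; exists p; rewrite ?inE.
Qed.

(** Double counting of incident pairs. *)
Lemma card_points_lines k : (0 < k)%N ->
    (forall p, #|[set l | inc p l]| = k) ->
    (forall l, #|[set p | inc p l]| = k) ->
  #|P| = #|L|.
Proof.
move=> k_gt0 degP degL; apply/eqP; rewrite -(eqn_pmul2r k_gt0); apply/eqP.
transitivity (\sum_p \sum_(l | inc p l) 1)%N.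
  by rewrite -sum_nat_const; apply: eq_bigr => p _; rewrite sum1dep_card degP.
rewrite (exchange_big_dep predT) //= -sum_nat_const.
by apply: eq_bigr => l _; rewrite sum1dep_card degL.
Qed.

Hypothesis no_digon : forall p p' l l', inc p l -> inc p l' -> inc p' l ->
  inc p' l' -> p = p' \/ l = l'.
Hypothesis no_triangle : forall p1 p2 p3 l1 l2 l3,
  inc p1 l2 -> inc p1 l3 -> inc p2 l1 -> inc p2 l3 -> inc p3 l1 -> inc p3 l2 ->
  [\/ p1 = p2, p2 = p3 | p1 = p3] \/ [\/ l1 = l2, l2 = l3 | l1 = l3].

Lemma inc_path_parity x s : path inc_adj x s ->
  is_inl (last x s) = odd (size s) (+) is_inl x.
Proof.
elim: s x => [|y s IHs] x //= /andP[xy /IHs->].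
by case: x y xy => [p|l] [p'|l'] //= _; case: (odd _).
Qed.

Lemma inc_cycle_even s : cycle inc_adj s -> ~~ odd (size s).
Proof.
case: s => //= x s /inc_path_parity; rewrite last_rcons size_rcons /=.
by case: (odd _); case: x.
Qed.

Lemma inc_cycle_inl s : cycle inc_adj s -> (0 < size s)%N ->
  exists p s' n, rot n s = inl p :: s'.
Proof.
case: s => // -[p|l] s; first by exists p, s, 0; rewrite rot0.
case: s => [|[p|l'] s] //= _ _; exists p, (rcons s (inr l)), 1.
by rewrite rot1_cons.
Qed.

(** Cycles are even by bipartiteness; one of length 4 is a digon and one of length 6 a triangle. *)
Lemma inc_graph_girth_ge8 (s : seq inc_graph) : graph_cycle s -> (8 <= size s)%N.
Proof.
case=> s_gt2 /andP[s_cyc s_uniq].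
have s_even := inc_cycle_even s_cyc.
have [p [s' [n def_s]]] := inc_cycle_inl s_cyc (ltn_trans (isT : 0 < 2)%N s_gt2).
move: s_gt2 s_cyc s_uniq s_even.
rewrite -(size_rot n) -(rot_cycle n) -(rot_uniq n) {}def_s {s}.
case: s' => [|[?|l1] [|[p2|?] [|[?|l2] s]]] //=; rewrite ?andbF //.
case: s => [|[p3|?] s] /=; rewrite ?andbF //.
  rewrite !inE !andbT => _ /and4P[i1 i2 i3 i4] un _.
  by case: (no_digon i1 i4 i2 i3) un => ->; rewrite eqxx ?orbT ?andbF.
case: s => [|[?|l3] [|? [|? s]]] //=; rewrite ?andbF //.
rewrite !inE !andbT => _ /and5P[i1 i2 i3 i4 /andP[i5 i6]] un _.
by case: (no_triangle i6 i1 i3 i2 i4 i5) un => [][] ->;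
  rewrite eqxx ?orbT ?andbF.
Qed.

End IncidenceGraph.

(** * The quadrangle in affine coordinates *)

Section BaerConeGraph.
Variables (F : finFieldType) (f : {rmorphism F -> F}).
Hypothesis fK : involutive f.

(* The symplectic form is u0 v3 - u3 v0 + u1 v2 - u2 v1 and P = (0,0,0,1). The
   points off the line l0 joining P to (0,0,1,0) are (1,x,y,z), coded by
   [inl (x, y, z)], and (0,1,k,b), coded by [inr (k, b)]. The totally isotropic
   lines not through P are coded by [inl (x, w)] if they meet l0, and by
   [inr (k, b, c)], the line joining (1,0,b,c) to (0,1,k,b), if not. The
   points of l0 and the lines through P are all deleted. *)
Definition point : finType := (F * F * F + F * F)%type.
Definition line : finType := (F * F + F * F * F)%type.

Definition gq_inc (p : point) (l : line) : bool :=
  match p, l with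
  | inl (x, y, z), inl (x', w) => (x == x') && (w == z + x * y)
  | inl (x, y, z), inr (k, b, c) => (y == b + k * x) && (z == c + b * x)
  | inr (k, b), inr (k', b', _) => (k == k') && (b == b')
  | inr _, inl _ => false
  end.

(* B consists of the points spanned by (t, f t, h) with f h = h: those with first
   coordinate nonzero are (1, x, y) with x f(x) = 1 and y = x f(y). The plane
   through P and [inr (k, b, c)] is u2 = b u0 + k u1, a line of B iff k = f b,
   and its pole is (0,1,k,b); the plane through P and [inl (x, w)] is
   u1 = x u0, a line of B iff x f(x) = 1, and its pole is on l0. *)
Definition kept_point (p : point) : bool :=
  match p with
  | inl (x, y, _) => ~~ ((x * f x == 1) && (y == x * f y))
  | inr (k, b) => k != f b
  end.

Definition kept_line (l : line) : bool :=
  match l with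
  | inl (x, _) => x * f x != 1
  | inr (k, b, _) => k != f b
  end.

(** Attach to the line [inr (k, b, c)] the quadratic k t^2 + 2 b t + c, the value of z + t y at its
    point over t. If two such lines meet over x, their quadratics differ by (k - k') (t - x)^2. *)
Lemma secants_meet (k b c k' b' c' x : F) :
    b + k * x = b' + k' * x -> c + b * x = c' + b' * x ->
  b = b' + (k' - k) * x /\ c = c' - (k' - k) * x ^+ 2.
Proof.
move=> Ey Ez; have Eb : b = b' + (k' - k) * x.
  by rewrite -[b](addrK (k * x)) Ey; ring.
by split=> //; rewrite -[c](addrK (b * x)) Ez Eb; ring.
Qed.

Lemma parallel_secants_meet (k b c1 c2 m d c x1 x2 : F) :
    b + k * x1 = d + m * x1 -> c1 + b * x1 = c + d * x1 ->
    b + k * x2 = d + m * x2 -> c2 + b * x2 = c + d * x2 ->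
  c1 = c2.
Proof.
move=> Ey1 Ez1 Ey2 Ez2.
have [Eb1 ->] := secants_meet Ey1 Ez1; have [Eb2 ->] := secants_meet Ey2 Ez2.
have E : (m - k) * x1 = (m - k) * x2 by apply: (addrI d); rewrite -Eb1 -Eb2.
by congr (_ - _); rewrite !expr2 !mulrA E mulrAC E mulrAC.
Qed.

Lemma gq_no_digon p p' l l' : gq_inc p l -> gq_inc p l' -> gq_inc p' l ->
  gq_inc p' l' -> p = p' \/ l = l'.
Proof.
case: l => [[u w]|[[m d] c]]; case: l' => [[u' w']|[[m' d'] c']];
case: p => [[[x y] z]|[k b]]; case: p' => [[[x' y'] z']|[k' b']] //=.
- by do 2!(case/andP=> /eqP<- /eqP->); right.
- case/andP=> /eqP-> _ /andP[/eqP-> /eqP->] /andP[/eqP-> _].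
  by case/andP=> /eqP-> /eqP->; left.
- case/andP=> /eqP-> /eqP-> /andP[/eqP-> _].
  by case/andP=> /eqP-> /eqP-> /andP[/eqP-> _]; left.
- case/andP=> /eqP-> /eqP-> /andP[/eqP Ey /eqP Ez].
  case/andP=> /eqP-> /eqP-> /andP[/eqP Ey' /eqP Ez'].
  have [Ed Ec] := secants_meet Ey Ez; have [Ed' _] := secants_meet Ey' Ez'.
  have /eqP : (m' - m) * (x - x') = 0.
    suff: (m' - m) * x = (m' - m) * x' by rewrite mulrBr => ->; rewrite subrr.
    by apply: (addrI d'); rewrite -Ed -Ed'.
  rewrite mulf_eq0 !subr_eq0 => /orP[/eqP Em|/eqP->]; last by left.
  by right; rewrite Ed Ec Em subrr !mul0r addr0 subr0.
- case/andP=> _ /eqP-> /andP[_ /eqP Ez] /andP[/eqP<- /eqP Ed].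
  case/andP=> /eqP<- /eqP Ed'.
  by right; move: Ez; rewrite -Ed -Ed' => /addIr->.
- case/andP=> /eqP<- /eqP<- /andP[/eqP<- /eqP<-].
  by case/andP=> _ /eqP-> /andP[_ /eqP/addIr->]; right.
- by case/andP=> /eqP-> /eqP-> _ /andP[/eqP-> /eqP->]; left.
Qed.

Definition degenerate (p1 p2 p3 : point) (l1 l2 l3 : line) : Prop :=
  [\/ p1 = p2, p2 = p3 | p1 = p3] \/ [\/ l1 = l2, l2 = l3 | l1 = l3].

Lemma gq_no_triangle_special p1 p2 p3 u w m1 d1 c1 m2 d2 c2 :
    let l1 : line := inr (m1, d1, c1) in let l2 : line := inr (m2, d2, c2) in
    let l3 : line := inl (u, w) in
    gq_inc p1 l2 -> gq_inc p1 l3 -> gq_inc p2 l1 -> gq_inc p2 l3 ->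
    gq_inc p3 l1 -> gq_inc p3 l2 ->
  degenerate p1 p2 p3 l1 l2 l3.
Proof.
move=> l1 l2 l3; case: p1 => [[[x1 y1] z1]|[? ?] _ //].
case: p2 => [[[x2 y2] z2]|[? ?] _ _ _ //] /=.
case/andP=> /eqP Ey1 /eqP Ez1 /andP[/eqP Ex1 /eqP Ew1].
case/andP=> /eqP Ey2 /eqP Ez2 /andP[/eqP Ex2 /eqP Ew2].
case: p3 => [[[x3 y3] z3]|[k b]]; last first.
  case/andP=> /eqP Em1 /eqP Ed1 /andP[/eqP Em2 /eqP Ed2].
  have Ey : y1 = y2 by rewrite Ey1 Ey2 -Em1 -Em2 -Ed1 -Ed2 Ex1 Ex2.
  left; apply: Or31; congr (inl (_, _, _)); rewrite ?Ex1 ?Ex2 //.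
  by apply: (addIr (x1 * y1)); rewrite -Ew1 Ew2 Ey Ex1 Ex2.
case/andP=> /eqP Ey3 /eqP Ez3 /andP[/eqP Ey3' /eqP Ez3'].
have [Ed Ec] := secants_meet (etrans (esym Ey3) Ey3') (etrans (esym Ez3) Ez3').
(* Both quadratics take the value [w] at [u], and their difference has the double root [x3]. *)
have /eqP : (m2 - m1) * (u - x3) ^+ 2 = 0.
  transitivity ((z1 + x1 * y1) - (z2 + x2 * y2)); last by rewrite -Ew1 Ew2 subrr.
  by rewrite Ez1 Ez2 Ey1 Ey2 Ed Ec Ex1 Ex2; ring.
rewrite mulf_eq0 expf_eq0 /= !subr_eq0 => /orP[/eqP Em|/eqP Eu].
  right; apply: Or31; rewrite /l1 /l2 Ed Ec Em subrr !mul0r.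
  by rewrite addr0 subr0.
left; apply: Or33; congr (inl (_, _, _)); first by rewrite Ex1.
  by rewrite Ey1 Ex1 Eu -Ey3'.
by rewrite Ez1 Ex1 Eu -Ez3'.
Qed.

Lemma gq_no_triangle_secant p1 p2 p3 m1 d1 c1 m2 d2 c2 m3 d3 c3 :
    let l1 : line := inr (m1, d1, c1) in let l2 : line := inr (m2, d2, c2) in
    let l3 : line := inr (m3, d3, c3) in
    gq_inc p1 l2 -> gq_inc p1 l3 -> gq_inc p2 l1 -> gq_inc p2 l3 ->
    gq_inc p3 l1 -> gq_inc p3 l2 ->
  degenerate p1 p2 p3 l1 l2 l3.
Proof.
case: p1 => [[[x1 y1] z1]|[k1 b1]]; case: p2 => [[[x2 y2] z2]|[k2 b2]];
case: p3 => [[[x3 y3] z3]|[k3 b3]] l1 l2 l3 /=; rewrite /degenerate.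
- case/andP=> /eqP-> /eqP-> /andP[/eqP Ey1 /eqP Ez1].
  case/andP=> /eqP-> /eqP-> /andP[/eqP Ey2 /eqP Ez2].
  case/andP=> /eqP-> /eqP-> /andP[/eqP Ey3 /eqP Ez3].
  have [Ed1 Ec1] := secants_meet Ey1 Ez1; have [Ed2 Ec2] := secants_meet Ey2 Ez2.
  have [Ed3 Ec3] := secants_meet Ey3 Ez3.
  have E1 : (m3 - m2) * x1 + (m2 - m1) * x3 = (m3 - m1) * x2.
    by apply: (addrI d3); rewrite -Ed2 addrA -Ed1 -Ed3.
  have E2 : (m3 - m2) * x1 ^+ 2 + (m2 - m1) * x3 ^+ 2 = (m3 - m1) * x2 ^+ 2.
    apply: oppr_inj; apply: (addrI c3).
    by rewrite opprD addrA -Ec1 -Ec2 -Ec3.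
  (* With A = m3 - m2 and B = m2 - m1, this is (A + B) (A x1^2 + B x3^2) - (A x1 + B x3)^2 = A B (x1
     - x3)^2. *)
  have /eqP : (m3 - m2) * (m2 - m1) * (x1 - x3) ^+ 2 = 0.
    transitivity ((m3 - m1) * ((m3 - m2) * x1 ^+ 2 + (m2 - m1) * x3 ^+ 2)
      - ((m3 - m2) * x1 + (m2 - m1) * x3) ^+ 2); first by ring.
    by rewrite E1 E2; ring.
  rewrite mulf_eq0 expf_eq0 mulf_eq0 /= !subr_eq0 -orbA => /or3P[] /eqP E.
  + right; apply: Or32; rewrite /l2 /l3 Ed1 Ec1 E subrr !mul0r.
    by rewrite addr0 subr0.
  + right; apply: Or31; rewrite /l1 /l2 Ed3 Ec3 E subrr !mul0r.
    by rewrite addr0 subr0.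
  + by left; apply: Or33; rewrite Ey3 Ez3 E.
- case/andP=> /eqP-> /eqP-> /andP[/eqP Ey1 /eqP Ez1].
  case/andP=> /eqP-> /eqP-> /andP[/eqP Ey2 /eqP Ez2].
  case/andP=> /eqP Ek /eqP Eb /andP[/eqP Ek' /eqP Eb']; subst.
  right; apply: Or31; rewrite /l1 /l2.
  by rewrite (parallel_secants_meet Ey2 Ez2 Ey1 Ez1).
- case/andP=> /eqP-> /eqP-> /andP[/eqP Ey1 /eqP Ez1].
  case/andP=> /eqP Ek /eqP Eb /andP[/eqP Ek' /eqP Eb']; subst.
  case/andP=> /eqP-> /eqP-> /andP[/eqP Ey2 /eqP Ez2].
  right; apply: Or33; rewrite /l1 /l3.
  by rewrite (parallel_secants_meet Ey2 Ez2 (esym Ey1) (esym Ez1)).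
- case/andP=> _ _ _ /andP[/eqP-> /eqP->] _ /andP[/eqP-> /eqP->] _.
  by left; apply: Or32.
- case/andP=> /eqP Ek /eqP Eb /andP[/eqP Ek' /eqP Eb']; subst.
  case/andP=> /eqP-> /eqP-> /andP[/eqP Ey1 /eqP Ez1].
  case/andP=> /eqP-> /eqP-> /andP[/eqP Ey2 /eqP Ez2].
  right; apply: Or32; rewrite /l2 /l3.
  by rewrite (parallel_secants_meet (esym Ey2) (esym Ez2) (esym Ey1) (esym Ez1)).
- case/andP=> /eqP-> /eqP-> _ _ _ _ /andP[/eqP-> /eqP->].
  by left; apply: Or33.
- case/andP=> _ _ /andP[/eqP-> /eqP->] _ /andP[/eqP-> /eqP->] _ _.
  by left; apply: Or31.
- case/andP=> _ _ /andP[/eqP-> /eqP->] _ /andP[/eqP-> /eqP->] _ _.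
  by left; apply: Or31.
Qed.

Lemma gq_no_triangle p1 p2 p3 l1 l2 l3 :
    gq_inc p1 l2 -> gq_inc p1 l3 -> gq_inc p2 l1 -> gq_inc p2 l3 ->
    gq_inc p3 l1 -> gq_inc p3 l2 ->
  degenerate p1 p2 p3 l1 l2 l3.
Proof.
have special_meet p u w u' w' : gq_inc p (inl (u, w)) ->
    gq_inc p (inl (u', w')) -> (inl (u, w) : line) = inl (u', w').
  by case: p => [[[x y] z]|[]] //= /andP[/eqP<- /eqP->] /andP[/eqP<- /eqP->].
case: l1 l2 l3 => [[u1 w1]|[[m1 d1] c1]] [[u2 w2]|[[m2 d2] c2]]
  [[u3 w3]|[[m3 d3] c3]] i12 i13 i21 i23 i31 i32.
- by right; apply: Or31; apply: special_meet i31 i32.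
- by right; apply: Or31; apply: special_meet i31 i32.
- by right; apply: Or33; apply: special_meet i21 i23.
- have [] := gq_no_triangle_special i23 i21 i32 i31 i12 i13.
    by case=> E; left; [apply: Or32|apply: Or33|apply: Or31]; rewrite E.
  by case=> E; right; [apply: Or32|apply: Or33|apply: Or31]; rewrite E.
- by right; apply: Or32; apply: special_meet i12 i13.
- have [] := gq_no_triangle_special i31 i32 i13 i12 i23 i21.
    by case=> E; left; [apply: Or33|apply: Or31|apply: Or32]; rewrite E.
  by case=> E; right; [apply: Or33|apply: Or31|apply: Or32]; rewrite E.
- exact: gq_no_triangle_special.
- exact: gq_no_triangle_secant.
Qed.

(** * Regularity: each kept vertex loses exactly one neighbour *)

Lemma card_sig_nbrs (T : finType) (K Q : pred T) (phi : F -> T) :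
    injective phi -> (forall u, K u && Q u <-> exists t, u = phi t) ->
  #|[set u : {x | K x} | Q (val u)]| = #|F|.
Proof.
move=> phi_inj phiP; rewrite -(card_imset _ val_inj) -(card_codom phi_inj).
apply: eq_card => u; apply/imsetP/codomP => [[v + ->]|].
  by rewrite inE => Qv; apply/phiP; rewrite (valP v).
by case/phiP/andP=> Ku Qu; exists (Sub u Ku); rewrite ?inE SubK.
Qed.

(** Applying [f] turns the equation into f k = y - k x; eliminating f k leaves a linear equation in
    [k] with leading coefficient 1 - x f(x). Thus one secant through an affine point off the
    norm-one planes is deleted. *)
Lemma eq_conj_affine (x y k : F) : x * f x != 1 ->
  (k == f (y - k * x)) = (k == (f y - y * f x) / (1 - x * f x)).
Proof.
move=> Nx; have N0 : 1 - x * f x != 0 by rewrite subr_eq0 eq_sym.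
apply/eqP/eqP => [Ek|->]; last first.
  apply: (inv_inj fK); rewrite fK fmorph_div !(rmorphB, rmorphM, rmorph1) !fK.
  by field; rewrite N0.
have Efk : f k = y - k * x by rewrite [in LHS]Ek fK.
have Ek' : k = f y - (y - k * x) * f x by rewrite -Efk -rmorphM -rmorphB.
by apply: (canRL (mulfK N0)); rewrite mulrBr mulr1 {1}Ek'; ring.
Qed.

Lemma norm1_affine (x y k : F) : x * f x = 1 -> k = f (y - k * x) -> y = x * f y.
Proof.
move=> Nx Ek; have Efk : f k = y - k * x by rewrite [in LHS]Ek fK.
have -> : y = f k + k * x by rewrite Efk subrK.
by rewrite rmorphD rmorphM fK mulrDr mulrCA Nx mulr1 addrC mulrC.
Qed.

(** A kept secant has one deleted affine point. Its abscissa has the form f(d) / d with d = f b - k,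
    hence norm 1. *)
Lemma eq_secant_cone (x k b : F) : k != f b ->
  (x * f x == 1) && (b + k * x == x * f (b + k * x)) =
    (x == (b - f k) / (f b - k)).
Proof.
move=> nk; have n0 : f b - k != 0 by rewrite subr_eq0 eq_sym.
have n0' : b - f k != 0 by rewrite -(fmorph_eq0 f) rmorphB fK.
apply/andP/eqP => [[/eqP Nx /eqP E]|->]; last first.
  rewrite !(rmorphD, rmorphM, fmorphV, rmorphN) /= !fK.
  by split; apply/eqP; field; rewrite n0 n0'.
apply: (canRL (mulfK n0)); move: E.
rewrite rmorphD rmorphM mulrDr mulrCA Nx mulr1 => E.
by rewrite mulrBr -[x * f b](addrK (f k)) -E; ring.
Qed.

Lemma card_kept_lines_at (p : {p | kept_point p}) :
  #|[set l : {l | kept_line l} | gq_inc (val p) (val l)]| = #|F|.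
Proof.
case: p => -[[[x y] z]|[k b]] /= kp; last first.
  apply: (card_sig_nbrs (K := kept_line) (Q := gq_inc (inr (k, b)))
    (phi := fun c => inr (k, b, c))) => [c c' [] //|[[u w]|[[m d] c]] /=].
    by rewrite andbF; split=> // -[].
  split=> [/and3P[_ /eqP-> /eqP->]|[t [-> -> _]]]; first by exists c.
  by rewrite kp !eqxx.
(* At norm 1 the line meeting [l0] is the deleted one and all secants survive; otherwise it survives
   and takes the index [k0] of the deleted secant. *)
have [Nx|Nx] := eqVneq (x * f x) 1.
  move: kp; rewrite Nx eqxx /= => ny.
  apply: (card_sig_nbrs (K := kept_line) (Q := gq_inc (inl (x, y, z)))
    (phi := fun k => inr (k, y - k * x, z - (y - k * x) * x))).
    by move=> k k' [].
  case=> [[u w]|[[m d] c]] /=.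
    split=> [/and3P[+ /eqP E _]|[]//]; by rewrite -E Nx eqxx.
  split=> [/and3P[_ /eqP-> /eqP->]|[t [-> -> ->]]].
    by exists m; rewrite !addrK.
  rewrite !subrK !eqxx !andbT; apply: contraNneq ny => Et.
  by apply/eqP; apply: norm1_affine Nx Et.
pose k0 := (f y - y * f x) / (1 - x * f x).
have k0P m : (m == f (y - m * x)) = (m == k0) := eq_conj_affine y m Nx.
apply: (card_sig_nbrs (K := kept_line) (Q := gq_inc (inl (x, y, z)))
  (phi := fun k => if k == k0 then inl (x, z + x * y)
                   else inr (k, y - k * x, z - (y - k * x) * x))).
  move=> k k'; have [->|_] := eqVneq k k0; have [->|_] := eqVneq k' k0 => //.
  by case.
case=> [[u w]|[[m d] c]] /=.
  split=> [/and3P[_ /eqP<- /eqP->]|[t]]; first by exists k0; rewrite eqxx.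
  by case: ifP => // _ [-> ->]; rewrite Nx !eqxx.
split=> [/and3P[+ /eqP Ey /eqP Ez]|[t]].
  have -> : d = y - m * x by rewrite Ey addrK.
  by rewrite k0P => /negPf Em; exists m; rewrite Em Ez Ey !addrK.
case: ifP => // /negPf; rewrite -k0P => nt [-> -> ->].
by rewrite nt !subrK !eqxx.
Qed.

Lemma card_kept_points_on (l : {l | kept_line l}) :
  #|[set p : {p | kept_point p} | gq_inc (val p) (val l)]| = #|F|.
Proof.
case: l => -[[u w]|[[k b] c]] /= kl.
  apply: (card_sig_nbrs (K := kept_point) (Q := gq_inc^~ (inl (u, w)))
    (phi := fun y => inl (u, y, w - u * y))) => [y y' [] //|[[[x y] z]|[m d]] /=].
    split=> [/and3P[_ /eqP-> /eqP->]|[t [-> -> ->]]].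
      by exists y; rewrite addrK.
    by rewrite subrK !eqxx (negPf kl).
  by rewrite andbF; split=> // -[].
(* The point at infinity takes the index [x0] of the deleted affine point. *)
pose x0 := (b - f k) / (f b - k).
have x0P x : (x * f x == 1) && (b + k * x == x * f (b + k * x)) = (x == x0).
  exact: eq_secant_cone.
apply: (card_sig_nbrs (K := kept_point) (Q := gq_inc^~ (inr (k, b, c)))
  (phi := fun x => if x == x0 then inr (k, b)
                   else inl (x, b + k * x, c + b * x))).
  move=> x x'; have [->|_] := eqVneq x x0; have [->|_] := eqVneq x' x0 => //.
  by case.
case=> [[[x y] z]|[m d]] /=.
  split=> [/and3P[+ /eqP Ey /eqP Ez]|[t]].
    by rewrite Ey x0P => /negPf Ex; exists x; rewrite Ex Ez.
  by case: ifP => // Et [-> -> ->]; rewrite x0P Et !eqxx.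
split=> [/and3P[_ /eqP-> /eqP->]|[t]]; first by exists x0; rewrite eqxx.
by case: ifP => // _ [-> ->]; rewrite kl !eqxx.
Qed.

(** * The graph, its girth and its order *)

Definition baer_inc (p : {p | kept_point p}) (l : {l | kept_line l}) : bool :=
  gq_inc (val p) (val l).

Definition baer_graph : sgraph := inc_graph baer_inc.

Lemma baer_graph_regular : regular #|F| baer_graph.
Proof.
apply: inc_graph_regular; first exact: card_kept_lines_at.
exact: card_kept_points_on.
Qed.

Lemma baer_graph_girth : (2 < #|F|)%N -> has_girth baer_graph 8.
Proof.
move=> F_gt2; split; last first.
  apply: inc_graph_girth_ge8 => [p p' l l' i1 i2 i3 i4|p1 p2 p3 l1 l2 l3].
    by case: (gq_no_digon i1 i2 i3 i4) => /val_inj->; [left|right].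
  move=> i12 i13 i21 i23 i31 i32.
  by case: (gq_no_triangle i12 i13 i21 i23 i31 i32) => [][] /val_inj->;
    [left; apply: Or31|left; apply: Or32|left; apply: Or33|
     right; apply: Or31|right; apply: Or32|right; apply: Or33].
have [k k0 k1] : exists2 k : F, k != 0 & k != 1.
  have /subsetPn[k _] : ~~ ([set: F] \subset [set 0; 1]).
    apply: contraTN F_gt2 => /subset_leq_card; rewrite cardsT cards2 -leqNgt.
    by move/leq_trans; apply; case: eqVneq.
  by rewrite !inE negb_or => /andP[]; exists k.
have one_kept : (1 : F) != f 0 by rewrite rmorph0 oner_eq0.
have k_kept : k != f 0 by rewrite rmorph0.
have A_kept z : kept_point (inl (0, 0, z)) by rewrite /= mul0r eq_sym oner_eq0.
pose A z : baer_graph := inl (Sub (inl (0, 0, z) : point) (A_kept z)).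
pose B m (m_kept : m != f 0) : baer_graph :=
  inl (Sub (inr (m, 0) : point) m_kept).
pose D m c (m_kept : m != f 0) : baer_graph :=
  inr (Sub (inr (m, 0, c) : line) m_kept).
(* An octagon from two pairs of parallel secants with b = 0, of slopes 1 and [k]: lines of distinct
   slopes meet over x = 0, parallel ones at infinity. *)
exists [:: B _ one_kept; D _ 0 one_kept; A 0; D _ 0 k_kept;
           B _ k_kept; D _ 1 k_kept; A 1; D _ 1 one_kept].
split=> //; split=> //; apply/andP; split.
  by rewrite /= /baer_inc /= !mulr0 !addr0 !eqxx.
pose raw (v : baer_graph) : point + line :=
  match v with inl p => inl (val p) | inr l => inr (val l) end.
apply: (@map_uniq _ _ raw); rewrite /= !inE !eqE /=.
rewrite !(inj_eq (@inl_inj _ _), inj_eq (@inr_inj _ _), xpair_eqE).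
by rewrite !eqxx ![1 == k]eq_sym ![0 == 1]eq_sym (negPf k1) oner_eq0.
Qed.

(** There are q^3 + q^2 coded lines; q are deleted for each x of norm 1, as are the q^2 secants with
    k = f b. *)
Lemma card_kept_lines :
  (#|{: {l | kept_line l}}| + #|[set x : F | x * f x == 1]%R| * #|F| =
   #|F| ^ 3)%N.
Proof.
set N := [set x | _].
have -> : #|{: {l | kept_line l}}| = #|[set l | kept_line l]|.
  by rewrite card_sig cardsE.
pose C : {set line} := [set inl xw | xw in setX N [set: F]].
pose D : {set line} := [set inr (f bc.1, bc.1, bc.2) | bc in [set: F * F]].
have CD0 : [disjoint C & D].
  by apply/pred0P=> -[xw|kbc]; apply/andP=> -[/imsetP[? _ E] /imsetP[? _ E']].
have kept_lineC : ~: (C :|: D) = [set l | kept_line l].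
  apply/setP=> -[[x w]|[[k b] c]]; rewrite !inE /=.
    congr (~~ _); apply/orP/idP => [[]|Nx].
    - by case/imsetP=> -[x' w']; rewrite !inE => /andP[Nx _] [-> _].
    - by case/imsetP.

    by left; apply/imsetP; exists (x, w); rewrite ?inE ?Nx.
  congr (~~ _); apply/orP/eqP => [[]|->].
  - by case/imsetP.

  - by case/imsetP=> -[b' c'] _ [-> -> _].
  by right; apply/imsetP; exists (b, c); rewrite ?inE.
have cardC : #|C| = (#|N| * #|F|)%N.
  by rewrite card_imset ?cardsX ?cardsT // => xw xw' [].
have cardD : #|D| = (#|F| * #|F|)%N.
  by rewrite card_imset ?cardsT ?card_prod // => -[b c] [b' c'] [_ -> ->].
have cardL : #|line| = (#|F| * #|F| + #|F| ^ 3)%N.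
  by rewrite card_sum !card_prod !expnS expn0 muln1 mulnA.
have := cardsC (C :|: D); rewrite kept_lineC.
rewrite cardsU disjoint_setI0 // cards0 subn0 cardC cardD cardL; lia.
Qed.

End BaerConeGraph.

(** * Frobenius powers, norm-one elements and the bound *)

Lemma frobenius_rmorphism (F : finFieldType) (p m : nat) : p \in [pchar F] ->
  exists f : {rmorphism F -> F}, forall x, f x = x ^+ (p ^ m).
Proof.
move=> charFp; elim: m => [|m [f fE]]; first by exists idfun => x; rewrite expr1.
exists (pFrobenius_aut charFp \o f) => x.
by rewrite /= pFrobenius_autE fE -exprM -expnSr.
Qed.

(** The map t |-> t^(s-1) sends the s^2 - 1 nonzero elements to norm-one elements, with fibres of
    size at most s - 1, so its image has at least s + 1 elements. *)
Lemma card_norm1 (F : finFieldType) (s : nat) : (1 < s)%N -> #|F| = (s ^ 2)%N ->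
  (s < #|[set x : F | x * x ^+ s == 1]%R|)%N.
Proof.
move=> s_gt1 cardF; set N := [set x | _].
have s1_gt0 : (0 < s.-1)%N by lia.
have powN (t : F) : t != 0 -> t ^+ s.-1 \in N.
  move=> t0; rewrite inE; apply/eqP/(mulfI t0).
  rewrite mulr1 -exprM mulrA -exprS -exprD -[RHS]expf_card cardF.
  by congr (_ ^+ _); nia.
have fib (x : F) : (#|[set t : F | t ^+ s.-1 == x]%R| <= s.-1)%N.
  rewrite cardE -ltnS -(size_XnsubC x s1_gt0).
  apply: max_poly_roots; rewrite ?enum_uniq -?size_poly_eq0 ?size_XnsubC //.
  by apply/allP=> t; rewrite mem_enum inE rootE !hornerE subr_eq0.
have : (#|[set t : F | t != 0%R]| <= #|N| * s.-1)%N.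
  rewrite -sum1dep_card (partition_big (fun t => t ^+ s.-1) (mem N)) //=.
  rewrite -sum_nat_const leq_sum // => x _; apply: leq_trans (fib x).
  by rewrite sum1dep_card subset_leq_card //; apply/subsetP=> t;
    rewrite !inE => /andP[].
have -> : [set t : F | t != 0] = [set~ 0] by apply/setP=> t; rewrite !inE.
rewrite cardsC1 cardF; nia.
Qed.

Theorem theorem4p2 (R : rcfType) (p m q : nat) (p_prime : prime p)
    (m_gt0 : (0 < m)%N) (q_def : q = (p ^ (2 * m))%N) :
  exists n : nat, cage_order q 8 n /\
    n%:R <= 2 * (q%:R ^+ 3 - q%:R * Num.sqrt q%:R - q%:R) :> R.
Proof.
have s_gt1 : (1 < p ^ m)%N by rewrite -(exp1n m) ltn_exp2r // prime_gt1.
have q_sqr : q = ((p ^ m) ^ 2)%N by rewrite q_def mulnC expnM.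
move: s_gt1 q_sqr; set s := (p ^ m)%N => s_gt1 q_sqr.
have [F charFp cardF] : {F : finFieldType | p \in [pchar F] & #|F| = q}.
  by rewrite q_def; apply: pPrimePowerField; rewrite ?muln_gt0.
have [f fE] := frobenius_rmorphism m charFp.
have fK : involutive f.
  by move=> x; rewrite !fE -exprM mulnn -q_sqr -cardF expf_card.
have F_gt2 : (2 < #|F|)%N by rewrite cardF q_sqr; nia.
have [n cage_n n_le] :=
  cage_order_le (baer_graph_regular fK) (baer_graph_girth f F_gt2).
exists n; split; first by rewrite -cardF.
have card_norm : (s < #|[set x : F | x * f x == 1]%R|)%N.
  under eq_finset do rewrite fE.
  by apply: card_norm1; rewrite // cardF.
(* Points and lines are equinumerous, and at least s + 1 norm-one elements leave at most q^3 - q (s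
   + 1) lines. *)
have n_le2 : (n + 2 * (q * s + q) <= 2 * q ^ 3)%N.
  have := card_kept_lines f; move: n_le card_norm.
  rewrite card_sum (card_points_lines _ (card_kept_lines_at fK)
    (card_kept_points_on fK)) ?(ltn_trans _ F_gt2) // cardF.
  move: #|_| #|_| => K N; nia.
have -> : Num.sqrt q%:R = s%:R :> R by rewrite q_sqr natrX sqrtr_sqr ger0_norm.
move: n_le2; rewrite -(ler_nat R) !(natrD, natrM, natrX).
rewrite -lerBrDr => /le_trans; apply.
by rewrite le_eqVlt; apply/orP; left; apply/eqP; ring.
Qed.
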